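(* There is an absolute constant $c>0$ such that the following holds. If $\alpha\in(0,c)$, then for all sufficiently large $n$ (depending on $\alpha$) there is a set $A\subseteq(\mathbb{F}_5^n)^2$ with $|A|\ge\alpha 5^{2n}$ and \[\max_{(a,b)\neq(0,0)}\#\{(x,y)\in(\mathbb{F}_5^n)^2:\ (x,y),\ (x+a,y+b),\ (x+b,y-a),\ (x+a+b,y+b-a)\in A\}\ \le\ (1-c)\alpha^4 5^{2n},\] where the maximum ranges over $(a,b)\in(\mathbb{F}_5^n)^2\setminus\{(0,0)\}$. *)

(* Defs.v *)
From mathcomp Require Import all_boot all_order all_algebra.
From mathcomp Require Import all_reals.

Set Implicit Arguments.
Unset Strict Implicit.
Unset Printing Implicit Defensive.

Import Order.TTheory GRing.Theory Num.Theory.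
Local Open Scope ring_scope.

Definition squares_in (n : nat) (A : {set 'rV['F_5]_n * 'rV['F_5]_n})
    (a b : 'rV['F_5]_n) : {set 'rV['F_5]_n * 'rV['F_5]_n} :=
  [set p : 'rV['F_5]_n * 'rV['F_5]_n |
    [&& (p.1, p.2) \in A,
        (p.1 + a, p.2 + b) \in A,
        (p.1 + b, p.2 - a) \in A
      & (p.1 + a + b, p.2 + b - a) \in A]].

(* Main.v *)
Require Import Defs.
From Stdlib Require Import NArith.
From mathcomp Require Import all_boot all_order all_algebra.
From mathcomp Require Import all_reals.
From mathcomp Require Import ring lra zify.
From mathcomp Require Import sequences exp.

Set Implicit Arguments.
Unset Strict Implicit.
Unset Printing Implicit Defensive.

Import Order.TTheory GRing.Theory Num.Theory.
Local Open Scope ring_scope.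

(** The rotation [J (a, b) = (b, -a)] is diagonalizable over F_5, with
    eigenvalues 2 and -2. In eigencoordinates [u = x + 3y], [v = x + 2y], where
    the difference becomes [(s, t)], the vertices of a square are
    [u, u + s, u + 2s, u + 3s] in the first coordinate and
    [v, v + t, v + 3t, v + 4t] in the second one.

    Choose [A] at random, keeping a point with probability proportional to
    [weight (u.u) (u.v)] for a suitable function [weight] on F_5^2. For each
    [(s, t) <> 0] the values of these quadratic forms at the four vertices are
    affine in [u.u, u.s, u.t, u.v, v.s], and these parameters are asymptotically
    equidistributed up to the linear relations forced by a dependence between
    [s] and [t]. Only finitely many cases occur, and in each of them a
    computation shows that squares have density at most 253/256 times the
    fourth power of the density of [A].

    The equidistribution of [u.u] on an affine subspace is a second moment
    estimate: [u.u = (u + w).(u + w)] is, for fixed [w], an affine condition on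
    [u]. The random choice is made uniformly good for all differences by the
    method of conditional expectations with an exponential potential. *)

(** * Equidistribution of quadratic forms *)

Section Equidistribution.
Variable F : finFieldType.
Implicit Types n k l : nat.

Definition dot n (u v : 'rV[F]_n) : F := (u *m v^T) 0 0.

Lemma dotE n (u v : 'rV[F]_n) : u *m v^T = (dot u v)%:M.
Proof. by rewrite [LHS]mx11_scalar. Qed.

Lemma dotC n (u v : 'rV[F]_n) : dot u v = dot v u.
Proof.
rewrite /dot !mxE; apply: eq_bigr => j _.
by rewrite !mxE mulrC.
Qed.

Lemma dotDl n (u v w : 'rV[F]_n) : dot (u + v) w = dot u w + dot v w.
Proof. by rewrite /dot mulmxDl mxE. Qed.

Lemma dotZl n c (u v : 'rV[F]_n) : dot (c *: u) v = c * dot u v.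
Proof. by rewrite /dot -scalemxAl mxE. Qed.

Lemma dotDr n (u v w : 'rV[F]_n) : dot u (v + w) = dot u v + dot u w.
Proof. by rewrite dotC dotDl !(dotC u). Qed.

Lemma dotZr n c (u v : 'rV[F]_n) : dot u (c *: v) = c * dot u v.
Proof. by rewrite dotC dotZl dotC. Qed.

(** A right inverse [Z] of [S] shows that [u *m S^T] takes every value, so its fibres are translates
    of the kernel and have equal size. *)
Lemma card_affine_fiber k n (S : 'M[F]_(k, n)) (al : 'rV_k) : row_free S ->
  (#|[set u : 'rV_n | u *m S^T == al]| * #|F| ^ k = #|F| ^ n)%N.
Proof.
move=> /row_freeP[Z SZ].
have fibE b : #|[set u : 'rV_n | u *m S^T == b]| =
              #|[set u : 'rV_n | u *m S^T == 0]|.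
  rewrite -[RHS](card_imset _ (@addrI _ (b *m Z^T))); apply: eq_card => u.
  rewrite !inE; apply/eqP/imsetP => [uS|[w]].
    exists (u - b *m Z^T); last by rewrite addrC subrK.
    by rewrite inE mulmxBl uS -mulmxA -trmx_mul SZ trmx1 mulmx1 subrr.
  rewrite inE => /eqP wS ->.
  by rewrite mulmxDl wS addr0 -mulmxA -trmx_mul SZ trmx1 mulmx1.
have := card_mx F 1 n; rewrite mul1n => <-.
have := card_mx F 1 k; rewrite mul1n => <-.
rewrite -[RHS]sum1_card (partition_big (fun u : 'rV_n => u *m S^T) predT) //=.
rewrite (eq_bigr (fun=> #|[set u : 'rV_n | u *m S^T == al]|)) => [|b _].
  by rewrite sum_nat_const mulnC.
rewrite fibE -(fibE b) -sum1_card; apply: eq_bigl => u.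
by rewrite !inE.
Qed.

Lemma card_rowspace k n (S : 'M[F]_(k, n)) :
  (#|[set w : 'rV_n | (w <= S)%MS]| <= #|F| ^ k)%N.
Proof.
have := card_mx F 1 k; rewrite mul1n => <-.
apply: leq_trans (leq_imset_card (fun c : 'rV_k => c *m S) predT).
apply/subset_leq_card/subsetP => w; rewrite inE => /submxP[c ->].
exact: imset_f.
Qed.

Lemma row_free_col_mx k n (S : 'M[F]_(k, n)) (w : 'rV_n) :
  row_free S -> ~~ (w <= S)%MS -> row_free (col_mx S w).
Proof.
rewrite /row_free -addsmxE => /eqP rS wS.
have w0 : w != 0 by apply: contraNneq wS => ->; rewrite sub0mx.
have := mxrank_sum_cap S w; rewrite rS rank_rV w0.
suff -> : \rank (S :&: w)%MS = 0%N by rewrite addn0 => ->.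
apply/eqP; rewrite -leqn0 leqNgt; apply: contra wS => r0.
have : (w <= S :&: w)%MS.
  rewrite -(geq_leqif (mxrank_leqif_sup (capmxSr S w))).
  by rewrite rank_rV w0.
by move=> /submx_trans; apply; apply: capmxSl.
Qed.

(** * Level sets of [u.u] on an affine subspace, by second moments *)

Section Quadric.
Variables (k n : nat) (S : 'M[F]_(k, n)) (al : 'rV[F]_k).
Hypotheses (two_neq0 : 2%:R != 0 :> F) (S_free : row_free S).

Definition quadric (x : F) : {set 'rV[F]_n} :=
  [set u | (dot u u == x) && (u *m S^T == al)].

Let H := [set u : 'rV[F]_n | u *m S^T == al].

(** Pairs of points of [H] on a common level of the form, sorted by their difference [w]. *)
Definition quadric_pairs (w : 'rV[F]_n) : {set 'rV[F]_n} :=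
  [set u in H | (u + w \in H) && (dot (u + w) (u + w) == dot u u)].

(** Off the row space of [S], the equation [(u + w).(u + w) = u.u] becomes [u.w = - w.w / 2], a
    further independent affine condition on [u]. On the row space, which has at most [#|F| ^ k]
    elements, the trivial bound [#|H|] is affordable. *)
Lemma card_quadric_pairs (w : 'rV[F]_n) :
  (#|quadric_pairs w|
     * #|F| ^ k.+1 <= (w *m S^T == 0)%R * #|F| ^ n
                      + (w <= S)%MS * (#|F| * #|F| ^ n))%N.
Proof.
have [wS0|wS0] := boolP (w *m S^T == 0); last first.
  rewrite (_ : quadric_pairs w = set0) ?cards0 ?mul0n //.
  apply/setP => u; rewrite !inE mulmxDl.
  case: eqP => //= ->.
  by rewrite -subr_eq0 addrAC subrr add0r (negPf wS0).
have [wS|wS] := boolP (w <= S)%MS.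
  rewrite !mul1n; apply: leq_trans (leq_addl _ _).
  rewrite expnSr mulnA mulnC leq_mul2l; apply/orP; right.
  rewrite -(card_affine_fiber al S_free) leq_mul2r; apply/orP; right.
  by apply/subset_leq_card/subsetP => u; rewrite !inE => /andP[].
rewrite mul0n addn0 mul1n.
rewrite -[k.+1]addn1.
rewrite -(card_affine_fiber (row_mx al (- (dot w w / 2%:R))%:M)
            (row_free_col_mx S_free wS)).
rewrite leq_mul2r; apply/orP; right.
apply/subset_leq_card/subsetP => u; rewrite !inE => /and3P[/eqP uS _ /eqP uw].
rewrite tr_col_mx mul_mx_row uS dotE; apply/eqP; congr (row_mx _ _%:M).
move: uw; rewrite dotDl !dotDr (dotC w u) -[RHS]addr0 -addrA => /addrI uw.
apply: (mulIf two_neq0); rewrite mulNr divfK //.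
by apply/eqP; rewrite -addr_eq0 mulr_natr mulr2n -addrA uw.
Qed.

(** The second moment counts pairs [(u, u + w)] on a common level. Differences inside [H] lie in the
    kernel of [S^T], which has [#|H|] elements; the second term pays for those in the row space of
    [S]. *)
Lemma sum_sqr_quadric :
  ((\sum_x #|quadric x| ^ 2) * #|F| ^ k.+1 <=
     #|H| * #|F| ^ n + #|F| ^ k * (#|F| * #|F| ^ n))%N.
Proof.
have -> : (\sum_x #|quadric x| ^ 2 =
  \sum_w #|quadric_pairs w|)%N.
  transitivity (\sum_x \sum_(u in quadric x) #|quadric x|)%N.
    by apply: eq_bigr => x _; rewrite sum_nat_const expnS expn1.
  rewrite (exchange_big_dep predT) //=.
  transitivity (\sum_(u in H) #|quadric (dot u u)|)%N.
    rewrite [RHS]big_mkcond /=; apply: eq_bigr => u _.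
    rewrite inE; case: ifP => uH.
      by rewrite (bigD1 (dot u u)) /= ?inE ?eqxx ?uH // big1 ?addn0 // => x;
        rewrite inE eq_sym => /andP[/andP[/eqP -> _]]; rewrite eqxx.
    by rewrite big1 // => x; rewrite inE uH andbF.
  transitivity (\sum_(u in H) \sum_w (u \in quadric_pairs w))%N.
    apply: eq_bigr => u; rewrite inE => uH.
    rewrite -sum1_card big_mkcond /= (reindex_inj (@addrI _ u)) /=.
    by apply: eq_bigr => w _; rewrite !inE uH /= andbC; case: (_ && _).
  rewrite exchange_big /=; apply: eq_bigr => w _.
  rewrite -sum1_card [LHS]big_mkcond [RHS]big_mkcond /=.
  apply: eq_bigr => u _; rewrite !inE.
  by case: (_ == al) => //; case: (_ && _).
rewrite big_distrl /=.
apply: leq_trans (leq_sum _ (fun w _ => card_quadric_pairs w)) _.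
rewrite big_split /= -!big_distrl /=.
rewrite leq_add //.
  rewrite leq_mul2r; apply/orP; right.
  rewrite -(leq_pmul2r (_ : 0 < #|F| ^ k)%N) ?expn_gt0; last first.
    by rewrite (cardD1 0) inE.
  rewrite card_affine_fiber // -(card_affine_fiber 0 S_free).
  rewrite leq_mul2r; apply/orP; right.
  rewrite -sum1_card [leqRHS]big_mkcond /=; apply: leq_sum => w _.
  by rewrite inE; case: (_ == _).
rewrite leq_mul2r; apply/orP; right.
apply: leq_trans (card_rowspace S).
rewrite -sum1_card [leqRHS]big_mkcond /=; apply: leq_sum => w _.
by rewrite inE; case: (_ <= _)%MS.
Qed.

(** One squared deviation is at most the sum of all of them, whose main terms cancel because
    [#|H| * #|F| ^ k = #|F| ^ n]. *)
Lemma quadric_deviation (R : realDomainType) x :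
  ((#|F| * #|quadric x|)%:R - #|H|%:R) ^+ 2 <= (#|F| ^ n.+2)%:R :> R.
Proof.
set q := #|F|; set M := #|H|.
have q_gt0 : (0 < q)%N by rewrite /q (cardD1 0) inE.
have sumN : (\sum_y #|quadric y| = M)%N.
  rewrite /M -sum1_card (partition_big (fun u => dot u u) predT) //=.
  apply: eq_bigr => y _; rewrite -sum1_card; apply: eq_bigl => u.
  by rewrite !inE andbC.
apply: (@le_trans _ _ (\sum_y ((q * #|quadric y|)%:R - M%:R) ^+ 2)).
  rewrite (bigD1 x) //= lerDl sumr_ge0 // => y _; exact: sqr_ge0.
have -> : \sum_y ((q * #|quadric y|)%:R - M%:R) ^+ 2 =
    q%:R ^+ 2 * (\sum_y #|quadric y| ^ 2)%:R - q%:R * M%:R ^+ 2 :> R.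
  have -> : q%:R * M%:R ^+ 2 = 2%:R * q%:R * M%:R * (\sum_y #|quadric y|)%:R
              - \sum_(y : F) M%:R ^+ 2 :> R.
    rewrite sumN sumr_const -/q -[X in _ = _ - X]mulr_natl; ring.
  rewrite !natr_sum !big_distrr /= opprB addrA addrAC -!sumrN -!big_split /=.
  by apply: eq_bigr => y _; rewrite natrM natrX; ring.
have Mq : M%:R * q%:R ^+ k = q%:R ^+ n :> R.
  by rewrite -!natrX -natrM (card_affine_fiber al S_free).
rewrite natrX; have := sum_sqr_quadric; rewrite -(ler_nat R) -/q.
have : 0 < q%:R :> R by rewrite ltr0n.
rewrite !natrD !natrM !natrX -/M; move: Mq.
move: (q%:R : R) (M%:R : R) ((\sum_y _)%N%:R : R) => a b c Mq a_gt0 le_Sq.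
rewrite -(ler_pM2r (_ : 0 < a ^+ k.+1)) ?exprn_gt0 //.
have -> : (a ^+ 2 * c - a * b ^+ 2) * a ^+ k.+1 =
    a ^+ 2 * (c * a ^+ k.+1 - b * (b * a ^+ k)) by rewrite !exprS; ring.
have -> : a ^+ n.+2 * a ^+ k.+1 = a ^+ 2 * (a ^+ k * (a * a ^+ n)).
  by rewrite !exprS; ring.
by rewrite Mq ler_wpM2l ?sqr_ge0 // lerBlDl.
Qed.

End Quadric.

(** * Joint level sets of [u.u] and [u.v] *)

Section LevelSets.
Variables (k l n : nat) (S : 'M[F]_(k, n)) (T : 'M[F]_(l, n)).
Hypotheses (two_neq0 : 2%:R != 0 :> F).
Hypotheses (S_free : row_free S) (T_free : row_free T).

Definition level_set x (al : 'rV_k) y (be : 'rV_l) :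
    {set 'rV[F]_n * 'rV[F]_n} :=
  [set p | (p.1 \in quadric S al x) &&
           ((dot p.1 p.2 == y) && (p.2 *m T^T == be))].

(** If [u] is outside the row space of [T], then [u.v = y] is independent of the conditions imposed
    by [T]; the few other [u] get the trivial bound. *)
Lemma card_level_set_section (u : 'rV[F]_n) y be :
  (#|[set v : 'rV[F]_n | (dot u v == y) && (v *m T^T == be)]| * #|F| ^ l.+1
     <= #|F| ^ n + (u <= T)%MS * (#|F| * #|F| ^ n))%N.
Proof.
have [uT|uT] := boolP (u <= T)%MS.
  rewrite mul1n; apply: leq_trans (leq_addl _ _).
  rewrite expnSr mulnA mulnC leq_mul2l; apply/orP; right.
  rewrite -(card_affine_fiber be T_free) leq_mul2r; apply/orP; right.
  by apply/subset_leq_card/subsetP => v; rewrite !inE => /andP[].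
rewrite mul0n addn0 -[l.+1]addn1.
rewrite -(card_affine_fiber (row_mx be y%:M) (row_free_col_mx T_free uT)).
rewrite leq_mul2r; apply/orP; right.
apply/subset_leq_card/subsetP => v; rewrite !inE => /andP[/eqP uv /eqP vT].
by rewrite tr_col_mx mul_mx_row vT dotE dotC uv.
Qed.

Lemma card_level_set_quadric x al y be :
  (#|level_set x al y be| * #|F| ^ l.+1
     <= #|quadric S al x| * #|F| ^ n + #|F| ^ l * (#|F| * #|F| ^ n))%N.
Proof.
have -> : (#|level_set x al y be| = \sum_(u in quadric S al x)
   #|[set v : 'rV[F]_n | (dot u v == y) && (v *m T^T == be)]|)%N.
  rewrite -sum1_card.
  rewrite (partition_big fst (mem (quadric S al x))) /=; last first.
    by move=> p; rewrite inE => /andP[].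
  apply: eq_bigr => u uP; rewrite -sum1_card.
  rewrite (reindex_onto (pair u) snd) /=; last first.
    by move=> [u' v] /andP[_ /eqP /= ->].
  apply: eq_bigl => v; rewrite !inE /= !eqxx !andbT.
  by move: uP; rewrite inE => ->.
rewrite big_distrl /=.
apply: leq_trans (leq_sum _ (fun u _ => card_level_set_section u y be)) _.
rewrite big_split /= -!big_distrl /= sum_nat_const leq_add2l.
rewrite leq_mul2r; apply/orP; right.
apply: leq_trans (card_rowspace T).
rewrite -sum1_card big_mkcond [leqRHS]big_mkcond /=; apply: leq_sum => u _.
by rewrite [in leqRHS]inE; case: (_ <= _)%MS; case: (_ \in _).
Qed.

(** The first smallness condition bounds the relative excess of the quadric by [eta]; the second
    does so for the contribution of the [u] in the row space of [T]. Together they cost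
    [2 * eta]. *)
Lemma card_level_set (R : realFieldType) (eta : R) x al y be : 0 <= eta ->
    (#|F| ^ (2 * k + 2))%:R <= eta ^+ 2 * (#|F| ^ n)%:R ->
    (#|F| ^ (k + l + 2))%:R <= eta * (#|F| ^ n)%:R ->
  (#|level_set x al y be| * #|F| ^ (k + l + 2))%:R
     <= (1 + 2%:R * eta) * (#|F| ^ (2 * n))%:R.
Proof.
move=> eta_ge0.
have := card_level_set_quadric x al y be; rewrite -(ler_nat R).
have := quadric_deviation al two_neq0 S_free R x.
have : #|[set u : 'rV_n | u *m S^T == al]|%:R * #|F|%:R ^+ k = #|F|%:R ^+ n :> R.
  by rewrite -!natrX -natrM (card_affine_fiber al S_free).
have q_gt0 : 0 < #|F|%:R :> R by rewrite ltr0n (cardD1 0) inE.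
rewrite !natrX !natrD !natrM !natrX; move: q_gt0.
move: #|F|%:R #|[set u | _]|%:R #|quadric S al x|%:R => q M N.
move: #|level_set _ _ _ _|%:R => L q_gt0.
have -> : q ^+ (2 * k + 2) = (q ^+ k.+1) ^+ 2.
  by rewrite -exprM; congr (q ^+ _); lia.
have -> : q ^+ (2 * n) = q ^+ n * q ^+ n by rewrite -exprD; congr (q ^+ _); lia.
have -> : q ^+ (k + l + 2) = q ^+ l.+1 * q ^+ k.+1.
  by rewrite -exprD; congr (q ^+ _); lia.
have -> : q ^+ n.+2 = q ^+ 2 * q ^+ n by rewrite -exprD.
move=> Mq dev leL le1 le2.
have qk_gt0 : 0 < q ^+ k.+1 by rewrite exprn_gt0.
have qn_gt0 : 0 < q ^+ n by rewrite exprn_gt0.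
have dev' : q ^+ k * (q * N - M) <= eta * q ^+ n.
  (* The deviation is only known through its square, so its sign is settled before squares are
     compared. *)
  have [?|pos] := lerP (q ^+ k * (q * N - M)) 0.
    by apply: le_trans (mulr_ge0 _ _) => //; apply: ltW.
  rewrite -(@ler_pXn2r _ 2%N) ?nnegrE ?(ltW pos) ?mulr_ge0 ?(ltW qn_gt0) //.
  rewrite !exprMn.
  apply: (@le_trans _ _ ((q ^+ k) ^+ 2 * (q ^+ 2 * q ^+ n))).
    by apply: ler_wpM2l => //; apply: sqr_ge0.
  have -> : (q ^+ k) ^+ 2 * (q ^+ 2 * q ^+ n) = (q ^+ k.+1) ^+ 2 * q ^+ n.
    by rewrite [q ^+ k.+1]exprS; ring.
  have -> : eta ^+ 2 * (q ^+ n) ^+ 2 = eta ^+ 2 * q ^+ n * q ^+ n by ring.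
  by rewrite ler_wpM2r // ltW.
rewrite [leLHS]mulrA.
apply: le_trans (ler_wpM2r (ltW qk_gt0) leL) _.
have -> : (N * q ^+ n + q ^+ l * (q * q ^+ n)) * q ^+ k.+1 =
    (q ^+ k * (q * N - M) + M * q ^+ k) * q ^+ n + q ^+ l.+1 * q ^+ k.+1 * q ^+ n.
  by rewrite !exprS; ring.
rewrite Mq.
have : q ^+ k * (q * N - M) * q ^+ n <= eta * q ^+ n * q ^+ n.
  by rewrite ler_wpM2r // ltW.
have : q ^+ l.+1 * q ^+ k.+1 * q ^+ n <= eta * q ^+ n * q ^+ n.
  by rewrite ler_wpM2r // ltW.
lra.
Qed.

(** Sorting the pairs by [key] replaces the sum by one over uniform parameters. As [G] is
    nonnegative, upper bounds on the level sets suffice. *)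
Lemma sum_level_sets (R : realFieldType) (eta : R)
    (G : F -> 'rV[F]_k -> F -> 'rV[F]_l -> nat) : 0 <= eta ->
    (#|F| ^ (2 * k + 2))%:R <= eta ^+ 2 * (#|F| ^ n)%:R ->
    (#|F| ^ (k + l + 2))%:R <= eta * (#|F| ^ n)%:R ->
  ((\sum_(u : 'rV[F]_n) \sum_(v : 'rV[F]_n)
      G (dot u u) (u *m S^T) (dot u v) (v *m T^T)) * #|F| ^ (k + l + 2))%:R
   <= (1 + 2%:R * eta) * (#|F| ^ (2 * n))%:R
      * (\sum_x \sum_al \sum_y \sum_be G x al y be)%:R.
Proof.
move=> eta_ge0 le1 le2.
pose key (p : 'rV[F]_n * 'rV[F]_n) :=
  (dot p.1 p.1, p.1 *m S^T, (dot p.1 p.2, p.2 *m T^T)).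
pose G' (K : (F * 'rV[F]_k) * (F * 'rV[F]_l)) := G K.1.1 K.1.2 K.2.1 K.2.2.
have -> : (\sum_x \sum_al \sum_y \sum_be G x al y be = \sum_K G' K)%N.
  transitivity (\sum_xa \sum_yb G' (xa, yb))%N; last by rewrite pair_bigA.
  by rewrite pair_bigA; apply: eq_bigr => xa _; rewrite pair_bigA.
rewrite pair_bigA /= (partition_big key predT) //= big_distrl natr_sum.
rewrite natr_sum mulr_sumr; apply: ler_sum => K _.
rewrite (eq_bigr (fun=> G' K)) => [|p /eqP <-//].
rewrite sum_nat_const /= mulnAC natrM ler_wpM2r ?ler0n //.
case: K => -[x al] [y be].
apply: le_trans (card_level_set x al y be eta_ge0 le1 le2).
rewrite ler_nat leq_mul2r; apply/orP; right; apply/subset_leq_card/subsetP.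
move=> p pK.
have /andP[/eqP[<- <-] /eqP[<- <-]] :
  ((key p).1 == (x, al)) && ((key p).2 == (y, be)) by [].
by rewrite !inE !eqxx.
Qed.

End LevelSets.
End Equidistribution.

(** * Rounding a density to a set *)

Section Rounding.
Variable R : realType.

(** Multiply by [1 - y]: the left side is at most 1 since [1 - y <= expR (- y)], and the right side
    becomes [1 + y ^ 2 * (1 - 2 * y)]. *)
Lemma expR_le_quadratic (y : R) : y <= 2^-1 -> expR y <= 1 + y + 2%:R * y ^+ 2.
Proof.
move=> y_le; have y1 : 0 < 1 - y by lra.
rewrite -(ler_pM2r y1); apply: (@le_trans _ _ 1).
  rewrite -[leRHS](expRxMexpNx_1 y) ler_pM2l ?expR_gt0 //.
  by have := expR_ge1Dx (- y).
have : 0 <= y ^+ 2 * (1 - 2%:R * y) by rewrite mulr_ge0 ?sqr_ge0 //; lra.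
rewrite !expr2; nra.
Qed.

(** A Hoeffding-type bound: around the mean [m] the linear terms cancel and the quadratic ones add
    up to [2 * theta * (1 - theta) * d ^ 2]. *)
Lemma expR_two_points (theta a b : R) : 0 <= theta <= 1 -> `|a - b| <= 2^-1 ->
  theta * expR a + (1 - theta) * expR b <=
  expR (theta * a + (1 - theta) * b + 2%:R * (a - b) ^+ 2).
Proof.
move=> /andP[t0 t1]; rewrite ler_norml => /andP[d1 d2].
set m := theta * a + (1 - theta) * b; set d := a - b in d1 d2 *.
have -> : a = m + (1 - theta) * d by rewrite /m /d; ring.
have -> : b = m + - (theta * d) by rewrite /m /d; ring.
clearbody m d; rewrite !expRD.
have e1 : expR ((1 - theta) * d)
    <= 1 + (1 - theta) * d + 2%:R * ((1 - theta) * d) ^+ 2.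
  by apply: expR_le_quadratic; nra.
have e2 : expR (- (theta * d)) <= 1 + - (theta * d) + 2%:R * (- (theta * d)) ^+ 2.
  by apply: expR_le_quadratic; nra.
have e3 : 1 + 2%:R * d ^+ 2 <= expR (2%:R * d ^+ 2) by apply: expR_ge1Dx.
rewrite mulrCA [X in _ + X]mulrCA -mulrDr ler_pM2l ?expR_gt0 //.
apply: le_trans e3.
have := ler_wpM2l t0 e1.
have t1' : 0 <= 1 - theta by lra.
have := ler_wpM2l t1' e2.
have : 0 <= d ^+ 2 * (1 - theta * (1 - theta)).
  by rewrite mulr_ge0 ?sqr_ge0 //; nra.
rewrite !expr2; nra.
Qed.

Variables (T J : finType) (P : J -> (T -> R) -> R) (c lam : R).

Definition upd (x : T -> R) q b : T -> R := fun p => if p == q then b else x p.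

Definition frac (x : T -> R) := forall p, 0 <= x p <= 1.

Hypothesis P_affine : forall j x q,
  P j x = x q * P j (upd x q 1) + (1 - x q) * P j (upd x q 0).
Hypothesis P_lipschitz : forall j x q, frac x ->
  `|P j (upd x q 1) - P j (upd x q 0)| <= c.
Hypotheses (lam_ge0 : 0 <= lam) (lam_c : lam * c <= 2^-1).

Lemma upd_frac x q b : frac x -> 0 <= b <= 1 -> frac (upd x q b).
Proof. by move=> fx fb p; rewrite /upd; case: eqP. Qed.

(* The potential is a pessimistic estimator: rounding the head of [s] at random,
   with mean [x q], does not increase its expectation. *)
Lemma conditional_rounding (t : J -> R) (s : seq T) (x : T -> R) : frac x ->
    (forall p, p \notin s -> x p = 0 \/ x p = 1) ->
    \sum_j expR (lam * (P j x - t j)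
                 + (size s)%:R * (2%:R * (lam * c) ^+ 2)) < 1 ->
  exists2 y : T -> R, (forall p, y p = 0 \/ y p = 1) & forall j, P j y < t j.
Proof.
elim: s x => [|q s IHs] x fx int_x potx.
  exists x => [p|j]; first exact: int_x.
  move: potx; rewrite (bigD1 j) //= mul0r addr0 => potx.
  have : expR (lam * (P j x - t j)) < 1.
    apply: le_lt_trans potx; rewrite lerDl sumr_ge0 // => i _.
    exact: expR_ge0.
  rewrite expR_lt1; have := lam_ge0; case: (ltP (P j x) (t j)) => //.
  by move=> le_t l0; rewrite ltNge mulr_ge0 // subr_ge0.
(* The summand with [size s] prepays the quadratic error of [expR_two_points] for every coordinate
   still to be rounded. *)
pose pot b := \sum_j expR (lam * (P j (upd x q b) - t j)
                           + (size s)%:R * (2%:R * (lam * c) ^+ 2)).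
have [pot_lt|pot_ge] : (exists2 b, (b = 0 \/ b = 1) & pot b < 1) \/
    (1 <= pot 0 /\ 1 <= pot 1).
- case: (ltP (pot 0) 1) => h0; first by left; exists 0; [left|].
  case: (ltP (pot 1) 1) => h1; first by left; exists 1; [right|].
  by right.
- case: pot_lt => b b01 pot_lt; apply: (IHs (upd x q b)) => //.
    by apply: upd_frac => //; case: b01 => ->; rewrite lexx ler01.
  move=> p ps; rewrite /upd; case: eqP => [//|/eqP pq].
  by apply: int_x; rewrite inE negb_or pq.
exfalso; move: potx; apply/negP; rewrite -leNgt.
have xq := fx q.
(* The mean of the two potentials is at most the current one, so they cannot both reach 1. *)
apply: (@le_trans _ _ (x q * pot 1 + (1 - x q) * pot 0)).
  by case: pot_ge; case/andP: xq; nra.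
rewrite /pot !mulr_sumr -big_split /=; apply: ler_sum => j _.
have lip : `|lam * P j (upd x q 1) - lam * P j (upd x q 0)| <= lam * c.
  by rewrite -mulrBr normrM ger0_norm // ler_wpM2l // P_lipschitz.
set K := (size s)%:R * _.
apply: le_trans (expR_two_points xq _) _.
  rewrite [X in `|X|](_ : _ = lam * P j (upd x q 1) - lam * P j (upd x q 0)).
    by rewrite (le_trans lip).
  by ring.
rewrite ler_expR [P j x in leRHS](P_affine j x q) /=.
rewrite -[(size s).+1%:R]natr1 [(_%:R + 1) * _]mulrDl mul1r -/K.
have : (lam * P j (upd x q 1) - lam * P j (upd x q 0)) ^+ 2 <= (lam * c) ^+ 2.
  rewrite -[leLHS]real_normK ?num_real // ler_pXn2r ?nnegrE ?(le_trans _ lip) //.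
move: (P j (upd x q 1)) (P j (upd x q 0)) K => p1 p0 K sqr_le.
rewrite [leLHS](_ : _ = lam * (x q * p1 + (1 - x q) * p0 - t j)
  + (K + 2%:R * (lam * p1 - lam * p0) ^+ 2)); last by ring.
by rewrite !lerD2l ler_wpM2l.
Qed.

End Rounding.

(** * Counting patterns in a random set *)

Section RandomSet.
Variable R : realType.

Section PatternCount.
Variables (T : finType) (m : nat).

Lemma prod_upd_hit (f : 'I_m -> T) (x : T -> R) q b i : injective f -> f i = q ->
  \prod_k upd x q b (f k) = b * \prod_(k | k != i) x (f k).
Proof.
move=> f_inj fi; rewrite (bigD1 i) //= {1}/upd fi eqxx; congr (_ * _).
by apply: eq_bigr => k ki; rewrite /upd -fi (inj_eq f_inj) (negPf ki).
Qed.

Lemma prod_upd_miss (f : 'I_m -> T) (x : T -> R) q b :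
  (forall i, f i != q) -> \prod_k upd x q b (f k) = \prod_k x (f k).
Proof. by move=> fq; apply: eq_bigr => k _; rewrite /upd (negPf (fq k)). Qed.

Variable g : T -> 'I_m -> T.
Hypothesis g_inj : forall p, injective (g p).
Hypothesis g_injl : forall i, injective (g^~ i).

(** The expected number of patterns when each [p] is kept independently with probability [x p], the
    vertices of a pattern being distinct. *)
Definition pattern_count (x : T -> R) : R := \sum_p \prod_i x (g p i).

Lemma hit_or_miss (I : finType) (f : I -> T) q :
  (exists i, f i = q) \/ forall i, f i != q.
Proof.
have [/existsP[i /eqP fi]|/existsPn h] := boolP [exists i, f i == q].
  by left; exists i.
by right.
Qed.

(** By injectivity of [g p], the factor [x q] occurs at most once in each product. *)
Lemma pattern_count_affine x q : pattern_count x =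
  x q * pattern_count (upd x q 1) + (1 - x q) * pattern_count (upd x q 0).
Proof.
rewrite /pattern_count !mulr_sumr -big_split /=; apply: eq_bigr => p _.
have [[i gi]|miss] := hit_or_miss (g p) q.
  rewrite !(prod_upd_hit _ _ (@g_inj p) gi) (bigD1 i) //= gi; ring.
rewrite !prod_upd_miss //; ring.
Qed.

Lemma prod_frac (f : 'I_m -> T) (x : T -> R) (Q : pred 'I_m) : frac x ->
  0 <= \prod_(k | Q k) x (f k) <= 1.
Proof.
move=> fx; apply/andP; split.
  by apply: prodr_ge0 => k _; case/andP: (fx (f k)).
by apply: prodr_ile1 => k _; exact: fx.
Qed.

(** For each [i] at most one [p] has [g p i = q], so at most [m] products change, each by at most
    1. *)
Lemma pattern_count_lipschitz x q : frac x ->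
  `|pattern_count (upd x q 1) - pattern_count (upd x q 0)| <= m%:R.
Proof.
move=> fx; rewrite /pattern_count -sumrB.
apply: le_trans (ler_norm_sum _ _ _) _.
apply: (@le_trans _ _ (\sum_p \sum_(i < m) (g p i == q)%:R)).
  apply: ler_sum => p _; have [[i gi]|miss] := hit_or_miss (g p) q.
    rewrite !(prod_upd_hit _ _ (@g_inj p) gi) mul1r mul0r subr0.
    have /andP[ge0 le1] := prod_frac (g p) (predC1 i) fx.
    rewrite ger0_norm // (le_trans le1) // (bigD1 i) //= gi eqxx lerDl.
    by apply: sumr_ge0 => k _.
  by rewrite !prod_upd_miss // subrr normr0 sumr_ge0.
rewrite exchange_big /= -[leRHS]mulr1 -[m in leRHS]card_ord mulr_natl -sumr_const.
apply: ler_sum => i _; rewrite -natr_sum lern1.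
have [[p gp]|miss] := hit_or_miss (g^~ i) q.
  rewrite (bigD1 p) //= gp eqxx big1 ?addn0 // => p' pp'.
  by rewrite -gp (inj_eq (@g_injl i)) (negPf pp').
by rewrite big1 // => p _; rewrite (negPf (miss p)).
Qed.

End PatternCount.

(** Uses [expR (kappa * M) >= (1 + kappa * M / 2) ^ 2], whose quadratic term is at least [M] by
    hypothesis. *)
Lemma expR_beats_linear (kappa M : R) : 0 < kappa -> 4%:R / kappa ^+ 2 <= M ->
  (1 + M) * expR (- (kappa * M)) < 1.
Proof.
move=> k0 leM; have k2 : 0 < kappa ^+ 2 by rewrite exprn_gt0.
have M0 : 0 < M by apply: lt_le_trans leM; rewrite divr_gt0.
have kM : 0 < kappa * M by rewrite mulr_gt0.
rewrite expRN -[_ / _ < _]/(_ * _ < _) ltr_pdivrMr ?expR_gt0 // mul1r.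
apply: (@lt_le_trans _ _ ((1 + kappa * M / 2%:R) ^+ 2)); last first.
  have -> : expR (kappa * M) = expR (kappa * M / 2%:R) ^+ 2.
    by rewrite expr2 -expRD; congr expR; field.
  by rewrite ler_pXn2r ?nnegrE ?expR_ge0 ?expR_ge1Dx //; lra.
move: leM; rewrite ler_pdivrMr // => leM.
have := ler_wpM2r (ltW M0) leM; rewrite !expr2; nra.
Qed.

(** There is one constraint per difference and one more, indexed by [None], for the size of [A];
    negating the sum turns that lower bound into an upper bound. *)
Lemma random_set (T D : finType) (g : D -> T -> 'I_4 -> T) (x : T -> R)
    (rho : R) :
    (forall d p, injective (g d p)) -> (forall d i, injective (g d ^~ i)) ->
    frac x -> 0 < rho <= 1 -> (#|D| <= #|T|)%N ->
    (16%:R / rho) ^+ 4 <= #|T|%:R ->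
  exists A : {set T},
    \sum_p x p - rho * #|T|%:R < #|A|%:R /\
    forall d, #|[set p | [forall i, g d p i \in A]]|%:R <
              pattern_count (g d) x + rho * #|T|%:R.
Proof.
move=> g_inj g_injl fx /andP[rho0 rho1] DT leT.
pose P (j : option D) (y : T -> R) :=
  if j is Some d then pattern_count (g d) y else - \sum_p y p.
have P_aff j y q :
    P j y = y q * P j (upd y q 1) + (1 - y q) * P j (upd y q 0).
  case: j => [d|] /=; first exact: pattern_count_affine.
  have updE b : \sum_p upd y q b p = b + \sum_(p | p != q) y p.
    rewrite (bigD1 q) //= /upd eqxx; congr (_ + _).
    by apply: eq_bigr => p /negPf ->.
  rewrite !updE (bigD1 q) //=; ring.
have P_lip j y q : frac y -> `|P j (upd y q 1) - P j (upd y q 0)| <= 4%:R.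
  case: j => [d|] fy /=; first exact: pattern_count_lipschitz.
  have updE b : \sum_p upd y q b p = b + \sum_(p | p != q) y p.
    rewrite (bigD1 q) //= /upd eqxx; congr (_ + _).
    by apply: eq_bigr => p /negPf ->.
  rewrite !updE [X in `|X|](_ : _ = -1) ?normrN1; last by ring.
  by rewrite ler1n.
(* With this [lam] each exponent is [(- rho ^ 2 / 64 + rho ^ 2 / 128) * #|T|], that is
   [- rho ^ 2 / 128 * #|T|]. *)
pose lam := rho / 64%:R.
have lam0 : 0 <= lam by rewrite /lam; lra.
have lam_c : lam * 4%:R <= 2^-1 by rewrite /lam; lra.
pose t j := P j x + rho * #|T|%:R.
have all_T p : p \notin enum T -> x p = 0 \/ x p = 1 by rewrite mem_enum.
have [|y y01 y_lt] := conditional_rounding P_aff P_lip lam0 lam_c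
    (t := t) fx all_T.
  rewrite -cardE (eq_bigr (fun=> expR (- (rho ^+ 2 / 128%:R * #|T|%:R)))).
    rewrite sumr_const card_option.
    apply: le_lt_trans (expR_beats_linear
      (kappa := rho ^+ 2 / 128%:R) (M := #|T|%:R) _ _).
    - rewrite -[leLHS]mulr_natl ler_wpM2r ?expR_ge0 // -natr1 addrC lerD2l.
      by rewrite ler_nat.
    - by rewrite divr_gt0 // exprn_gt0.
    (* The threshold [(16 / rho) ^ 4] is exactly [4 / kappa ^ 2] for [kappa = rho ^ 2 / 128]. *)
    - apply: le_trans leT; rewrite le_eqVlt; apply/orP; left; apply/eqP.
      by field; rewrite gt_eqF.
  by move=> j _; congr expR; rewrite /t /lam; field.
pose A := [set p | y p == 1].
have yA p : y p = (p \in A)%:R.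
  by rewrite inE; case: (y01 p) => ->; rewrite ?eqxx // eq_sym oner_eq0.
exists A; split.
  have := y_lt None; rewrite /t /=.
  have -> : \sum_p y p = #|A|%:R.
    by rewrite -sum1_card natr_sum [RHS]big_mkcond; apply: eq_bigr => p _;
       rewrite yA; case: (p \in A).
  lra.
move=> d; have := y_lt (Some d); rewrite /t /=; congr (_ < _).
rewrite /pattern_count -sum1_card natr_sum [RHS]big_mkcond.
apply: eq_bigr => p _; rewrite inE; case: forallP => [gA|gA].
  by rewrite big1 // => i _; rewrite yA gA.
have [i giA] : exists i, g d p i \notin A.
  by apply/existsP; rewrite -negb_forall; apply/forallP.
by rewrite (bigD1 i) //= yA (negPf giA) mul0r.
Qed.

End RandomSet.

(** * The weight *)

Section Table.

(* Found by numerical optimization; the row index is [u.u], the column index is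
   [u.v], and the mean is 4. *)
Definition weight_table : seq N :=
  [:: 2; 4; 5; 3; 6;
      0; 7; 6; 0; 7;
      0; 7; 0; 7; 7;
      6; 0; 7; 3; 3;
      7; 6; 0; 7; 0]%num.

(** Takes arbitrary natural representatives and returns a binary number, so that the sums below can
    be evaluated by [vm_compute]. *)
Definition weightN (i j : nat) : N :=
  nth 0%num weight_table (5 * (i %% 5) + j %% 5).

Definition weight (x y : 'F_5) : nat := N.to_nat (weightN x y).

(** The multiple of [t] at vertex [i] in the second coordinate: the eigenvalue [-2] is 3, and
    [1 + 3 = 4]. In the first coordinate the multiple is [i] itself. *)
Definition slope (i : nat) : nat := nth 0%N [:: 0; 1; 3; 4]%N i.

(* Product of the weights of the vertices, in terms of [z = s.s], [q = s.t],
   [X = u.u], [a = u.s], [e = u.t], [Y = u.v] and [b = v.s]. *)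
Definition square_weight (z q X a e Y b : 'F_5) : nat :=
  \prod_(i < 4) weight (X + (2 * i)%:R * a + (i * i)%:R * z)%R
    (Y + i%:R * b + (slope i)%:R * e + (i * slope i)%:R * q)%R.

Definition square_weightN (z q X a e Y b : nat) : N :=
  let f i := weightN (X + 2 * i * a + i * i * z)
                     (Y + i * b + slope i * e + i * slope i * q) in
  (f 0 * (f 1 * (f 2 * f 3)))%num.

Definition sumN (f : nat -> N) : N := (f 0 + (f 1 + (f 2 + (f 3 + f 4))))%num.

Definition allF5 (p : pred nat) : bool := [&& p 0, p 1, p 2, p 3 & p 4]%N.

Lemma weightNE (i j : nat) : weight i%:R j%:R = N.to_nat (weightN i j).
Proof. by rewrite /weight /weightN !val_Fp_nat // !modn_mod. Qed.

Lemma square_weightNE (z q X a e Y b : nat) :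
  N.to_nat (square_weightN z q X a e Y b) =
  square_weight z%:R q%:R X%:R a%:R e%:R Y%:R b%:R.
Proof.
have fE (i : nat) :
    weight (X%:R + (2 * i)%:R * a%:R + (i * i)%:R * z%:R)
      (Y%:R + i%:R * b%:R + (slope i)%:R * e%:R + (i * slope i)%:R * q%:R) =
    N.to_nat (weightN (X + 2 * i * a + i * i * z)
                      (Y + i * b + slope i * e + i * slope i * q)).
  by rewrite -!natrM -!natrD weightNE.
rewrite /square_weight !big_ord_recl big_ord0 muln1 !fE.
by rewrite /square_weightN !Nnat.N2Nat.inj_mul.
Qed.

Lemma forall_F5 (P : 'F_5 -> Prop) :
  (forall i : nat, (i < 5)%N -> P i%:R) -> forall x, P x.
Proof. by move=> h x; rewrite -[x]natr_Zp; apply: h; case: x. Qed.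

Lemma sumNE (f : nat -> N) (g : 'F_5 -> nat) :
  (forall i, N.to_nat (f i) = g i%:R) -> N.to_nat (sumN f) = (\sum_x g x)%N.
Proof.
move=> fg; rewrite /sumN !Nnat.N2Nat.inj_add ?plusE !fg.
have -> : (\sum_x g x = \sum_(i < 5) g i%:R)%N.
  by apply: eq_bigr => x _; rewrite -[x in LHS](@natr_Zp 3).
by rewrite !big_ord_recl big_ord0 addn0.
Qed.

Lemma allF5P (p : pred nat) i : allF5 p -> (i < 5)%N -> p i.
Proof. by case/and5P; case: i => [|[|[|[|[|]]]]]. Qed.

(** Keeps the comparison in binary, so that [253 * 5 ^ k] is never expanded in unary. *)
Lemma leq_N_bound k (m : nat) (x B : N) : N.to_nat x = m ->
  B = (253 * N.pow 5 (N.of_nat k))%num -> (x <=? B)%num -> (m <= 253 * 5 ^ k)%N.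
Proof.
move=> <- -> /N.leb_le le_x.
have -> : (5 ^ k = N.to_nat (N.pow 5 (N.of_nat k)))%N.
  elim: k {le_x} => [//|k IHk].
  by rewrite Nnat.Nat2N.inj_succ N.pow_succ_r' Nnat.N2Nat.inj_mul -IHk expnS.
rewrite -[X in (X * _)%N]/(N.to_nat 253) -[muln]/Nat.mul -Nnat.N2Nat.inj_mul.
lia.
Qed.

(** For independent [s] and [t] all five parameters are free. The mean weight 4 would give
    [4 ^ 4 = 256] in place of 253; the constant 790625 is [253 * 5 ^ 5]. *)
Lemma sum_square_weight_independent z q :
  (\sum_X \sum_a \sum_e \sum_Y \sum_b square_weight z q X a e Y b
     <= 253 * 5 ^ 5)%N.
Proof.
have check : allF5 (fun z => allF5 (fun q =>
  (sumN (fun X => sumN (fun a => sumN (fun e => sumN (fun Y => sumN (fun b =>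
     square_weightN z q X a e Y b))))) <=? 790625)%num)) by vm_compute.
elim/forall_F5: z => z /(allF5P check); elim/forall_F5: q => q lq /allF5P.
move=> /(_ _ lq); apply: leq_N_bound; last by [].
do 5! (apply: sumNE => ?); exact: square_weightNE.
Qed.

(** The case [t = l s], which forces [s.t = l (s.s)] and [u.t = l (u.s)]. *)
Lemma sum_square_weight_dependent z l :
  (\sum_X \sum_a \sum_Y \sum_b square_weight z (l * z)%R X a (l * a)%R Y b
     <= 253 * 5 ^ 4)%N.
Proof.
have check : allF5 (fun z => allF5 (fun l =>
  (sumN (fun X => sumN (fun a => sumN (fun Y => sumN (fun b =>
     square_weightN z (l * z) X a (l * a) Y b)))) <=? 158125)%num)) by vm_compute.
elim/forall_F5: z => z /(allF5P check); elim/forall_F5: l => l ll /allF5P.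
move=> /(_ _ ll); apply: leq_N_bound; last by [].
do 4! (apply: sumNE => ?); by rewrite square_weightNE !natrM.
Qed.

(** The case [s = 0], where only [u.u], [u.t] and [u.v] remain. *)
Lemma sum_square_weight_vertical :
  (\sum_X \sum_e \sum_Y square_weight 0%R 0%R X 0%R e Y 0%R <= 253 * 5 ^ 3)%N.
Proof.
have : (sumN (fun X => sumN (fun e => sumN (fun Y =>
     square_weightN 0 0 X 0 e Y 0))) <=? 31625)%num by vm_compute.
apply: leq_N_bound; last by [].
do 3! (apply: sumNE => ?); exact: square_weightNE.
Qed.

Lemma sum_weight : (\sum_x \sum_y (7 - weight x y) = 75)%N.
Proof.
have <- : N.to_nat (sumN (fun x => sumN (fun y => 7 - weightN x y)%num)) = 75%N.
  by vm_compute.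
symmetry; do 2! (apply: sumNE => ?).
by rewrite Nnat.N2Nat.inj_sub -weightNE.
Qed.

Lemma weight_le7 x y : (weight x y <= 7)%N.
Proof.
elim/forall_F5: x => x; elim/forall_F5: y => y ly lx; rewrite weightNE.
by case: x lx => [|[|[|[|[|]]]]] //; case: y ly => [|[|[|[|[|]]]]].
Qed.

End Table.

(** * Sums over row vectors with at most two entries *)

Section SmallRowVectors.
Variable F : finFieldType.

Lemma sum_row0 (h : 'rV[F]_0 -> nat) c :
  (forall v, h v = c) -> (\sum_v h v = c)%N.
Proof.
move=> hc; rewrite (eq_bigr (fun=> c)) // sum_nat_const.
by rewrite (card_mx F 1 0) muln0 expn0 mul1n.
Qed.

Lemma sum_row1 (h : F -> nat) : (\sum_(v : 'rV[F]_1) h (v 0 0)%R = \sum_x h x)%N.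
Proof.
rewrite (reindex (fun x : F => x%:M : 'rV_1)) /=.
  by apply: eq_bigr => x _; rewrite mxE.
exists (fun v : 'rV_1 => v 0 0) => [x|v] _; first by rewrite mxE.
by rewrite [RHS]mx11_scalar.
Qed.

Lemma sum_row2 (h : F -> F -> nat) :
  (\sum_(v : 'rV[F]_(1 + 1)) h (lsubmx v 0 0)%R (rsubmx v 0 0)%R =
   \sum_x \sum_y h x y)%N.
Proof.
rewrite pair_bigA /=.
rewrite (reindex (fun p : F * F => row_mx (p.1%:M : 'rV_1) (p.2%:M : 'rV_1))) /=.
  by apply: eq_bigr => p _; rewrite row_mxKl row_mxKr !mxE.
exists (fun v : 'rV_(1 + 1) => (lsubmx v 0 0, rsubmx v 0 0)) => [[x y]|v] _ /=.
  by rewrite row_mxKl row_mxKr !mxE.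
by rewrite -!mx11_scalar hsubmxK.
Qed.

End SmallRowVectors.

(** * Total weight of the squares with a given difference *)

Section SquareWeight.
Variables (R : realType) (n : nat) (eta : R).
Hypothesis (eta_ge0 : 0 <= eta) (eta_le1 : eta <= 1).
Hypothesis n_large : (5 ^ 6)%:R <= eta ^+ 2 * (5 ^ n)%:R.
Implicit Types u v s t : 'rV['F_5]_n.

Lemma dot0r u : dot u 0 = 0.
Proof. by rewrite /dot trmx0 mulmx0 mxE. Qed.

Lemma card_F5 : #|'F_5| = 5%N.
Proof. exact: card_Fp. Qed.

Lemma two_F5_neq0 : 2%:R != 0 :> 'F_5.
Proof. by []. Qed.

(** The exponent 6 in [n_large] is [2 * k + 2] at [k = 2], the largest number of linear conditions
    on [u]. *)
Lemma n_large_sqr k : (k <= 2)%N ->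
  (#|'F_5| ^ (2 * k + 2))%:R <= eta ^+ 2 * (#|'F_5| ^ n)%:R :> R.
Proof.
rewrite card_F5 => k2; apply: le_trans n_large.
by rewrite ler_nat leq_pexp2l //; lia.
Qed.

Lemma n_large_lin m : (m <= 6)%N ->
  (#|'F_5| ^ m)%:R <= eta * (#|'F_5| ^ n)%:R :> R.
Proof.
rewrite card_F5 => m6; apply: (@le_trans _ _ (eta ^+ 2 * (5 ^ n)%:R)).
  by apply: le_trans n_large; rewrite ler_nat leq_pexp2l.
by rewrite ler_wpM2r // expr2 ler_piMl.
Qed.

Definition square_sum s t : nat := (\sum_(u : 'rV['F_5]_n) \sum_(v : 'rV['F_5]_n)
  square_weight (dot s s) (dot s t) (dot u u) (dot u s) (dot u t)
    (dot u v) (dot v s))%N.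

Let bound : R := 253%:R * (1 + 2%:R * eta) * (5 ^ (2 * n))%:R.

Lemma square_sum_bound_of_params k (W C : nat) :
    (W * #|'F_5| ^ k)%:R <= (1 + 2%:R * eta) * (#|'F_5| ^ (2 * n))%:R * C%:R ->
    (C <= 253 * 5 ^ k)%N ->
  W%:R <= bound.
Proof.
rewrite card_F5 natrM => leW leC.
rewrite -(ler_pM2r (_ : 0 < (5 ^ k)%:R)) ?ltr0n ?expn_gt0 //.
apply: le_trans leW _.
rewrite [leRHS](_ : _ = (1 + 2%:R * eta) * (5 ^ (2 * n))%:R * (253 * 5 ^ k)%:R).
  rewrite ler_wpM2l ?ler_nat //; apply: mulr_ge0 => //.
  by move: eta_ge0; lra.
by rewrite /bound natrM; ring.
Qed.

(** Three cases: [s = 0], [t] a multiple of [s], and [s], [t] independent. The conditions on [u]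
    come from a basis of the span of [s] and [t]; those on [v] come from [s] alone, as [v.t] does
    not enter the weight. *)
Lemma square_sum_le s t : (s, t) != 0 -> (square_sum s t)%:R <= bound.
Proof.
move=> st0; have [s0|s0] := eqVneq s 0.
  have t0 : t != 0 by apply: contraNneq st0 => t0; rewrite s0 t0.
  have t_free : row_free t by rewrite /row_free rank_rV t0.
  have T_free : row_free (0 : 'M['F_5]_(0, n)) by rewrite /row_free mxrank0.
  apply: square_sum_bound_of_params sum_square_weight_vertical.
  have := sum_level_sets two_F5_neq0 t_free T_free
    (fun x (al : 'rV_1) y (_ : 'rV_0) => square_weight 0 0 x 0 (al 0 0) y 0)
    eta_ge0 (n_large_sqr (k := 1) isT) (n_large_lin (m := 3) isT).
  congr ((_ * _)%:R <= _ * _%:R).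
    rewrite /square_sum; apply: eq_bigr => u _; apply: eq_bigr => v _.
    by rewrite s0 [dot 0 t]dotC !dot0r.
  apply: eq_bigr => X _.
  rewrite -(sum_row1 (fun e => \sum_Y square_weight 0%R 0%R X 0%R e Y 0%R)%N).
  by apply: eq_bigr => al _; apply: eq_bigr => Y _; apply: sum_row0.
have s_free : row_free s by rewrite /row_free rank_rV s0.
have [/sub_rVP[l ->]|ts] := boolP (t <= s)%MS.
  apply: square_sum_bound_of_params (sum_square_weight_dependent (dot s s) l).
  have := sum_level_sets two_F5_neq0 s_free s_free
    (fun x (al : 'rV_1) y (be : 'rV_1) => square_weight (dot s s) (l * dot s s)
       x (al 0 0) (l * al 0 0) y (be 0 0))
    eta_ge0 (n_large_sqr (k := 1) isT) (n_large_lin (m := 4) isT).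
  congr ((_ * _)%:R <= _ * _%:R).
    rewrite /square_sum; apply: eq_bigr => u _; apply: eq_bigr => v _.
    by rewrite !dotZr.
  apply: eq_bigr => X _; rewrite -(sum_row1 (fun a => \sum_Y \sum_b
    square_weight (dot s s) (l * dot s s)%R X a (l * a)%R Y b)%N).
  apply: eq_bigr => al _; apply: eq_bigr => Y _.
  exact: (sum_row1 (fun b => square_weight (dot s s) (l * dot s s) X
    (al 0 0) (l * al 0 0) Y b)).
have st_free : row_free (col_mx s t) by apply: row_free_col_mx.
apply: square_sum_bound_of_params
  (sum_square_weight_independent (dot s s) (dot s t)).
have := sum_level_sets two_F5_neq0 st_free s_free
  (fun x (al : 'rV_(1 + 1)) y (be : 'rV_1) => square_weight (dot s s) (dot s t)
     x (lsubmx al 0 0) (rsubmx al 0 0) y (be 0 0))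
  eta_ge0 (n_large_sqr (k := 2) isT) (n_large_lin (m := 5) isT).
congr ((_ * _)%:R <= _ * _%:R).
  rewrite /square_sum; apply: eq_bigr => u _; apply: eq_bigr => v _.
  by rewrite tr_col_mx mul_mx_row row_mxKl row_mxKr.
apply: eq_bigr => X _; rewrite -(sum_row2 (fun a e => \sum_Y \sum_b
  square_weight (dot s s) (dot s t) X a e Y b)%N).
apply: eq_bigr => al _; apply: eq_bigr => Y _.
exact: (sum_row1 (fun b => square_weight (dot s s) (dot s t) X
  (lsubmx al 0 0) (rsubmx al 0 0) Y b)).
Qed.

(* Lower bound from the upper bounds, applied to [7 - weight]. *)
Lemma total_weight_ge : (4%:R - 6%:R * eta) * (5 ^ (2 * n))%:R <=
  (\sum_(u : 'rV['F_5]_n) \sum_(v : 'rV['F_5]_n)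
    weight (dot u u) (dot u v))%N%:R.
Proof.
have T_free : row_free (0 : 'M['F_5]_(0, n)) by rewrite /row_free mxrank0.
have := sum_level_sets two_F5_neq0 T_free T_free
  (fun x (_ : 'rV_0) y (_ : 'rV_0) => (7 - weight x y)%N)
  eta_ge0 (n_large_sqr (k := 0) isT) (n_large_lin (m := 2) isT).
have -> : (\sum_x \sum_(al : 'rV['F_5]_0) \sum_y \sum_(be : 'rV['F_5]_0)
    (7 - weight x y) = 75)%N.
  rewrite -sum_weight; apply: eq_bigr => x _; apply: sum_row0 => al.
  by apply: eq_bigr => y _; apply: sum_row0.
set W := (\sum_u \sum_v weight _ _)%N; set W' := (\sum_u _)%N.
have sumW : (W' + W = 7 * 5 ^ (2 * n))%N.
  rewrite /W' /W -big_split /=.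
  rewrite (eq_bigr (fun=> 7 * 5 ^ n)%N) => [|u _].
    rewrite sum_nat_const card_mx mul1n card_F5 mulnCA; congr (7 * _)%N.
    by rewrite -expnD; congr (5 ^ _)%N; lia.
  rewrite -big_split /= (eq_bigr (fun=> 7%N)) => [|v _]; last first.
    by rewrite subnK // weight_le7.
  by rewrite sum_nat_const card_mx mul1n card_F5 mulnC.
move: sumW; rewrite card_F5 (_ : 5 ^ (0 + 0 + 2) = 25)%N //.
move: (5 ^ (2 * n))%N => M /(congr1 (fun m => m%:R : R)).
(* The complement [7 - weight] has mean 3, which leaves [7 - 3 * (1 + 2 * eta) = 4 - 6 * eta]. *)
rewrite natrD !natrM; lra.
Qed.

End SquareWeight.

(** * Squares in eigencoordinates *)

Section Corners.
Variable n : nat.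
Local Notation point := ('rV['F_5]_n * 'rV['F_5]_n)%type.
Implicit Types d p : point.

(** The default [p] of [nth] is never reached, as [i < 4]. *)
Definition corner d p (i : 'I_4) : point :=
  nth p [:: p; (p.1 + d.1, p.2 + d.2); (p.1 + d.2, p.2 - d.1);
            (p.1 + d.1 + d.2, p.2 + d.2 - d.1)] i.

Definition eigL p : 'rV['F_5]_n := p.1 + 3%:R *: p.2.
Definition eigR p : 'rV['F_5]_n := p.1 + 2%:R *: p.2.
Definition uneig (q : point) : point := (3%:R *: q.2 - 2%:R *: q.1, q.1 - q.2).

Lemma eigL_uneig q : eigL (uneig q) = q.1.
Proof. by apply/rowP => j; rewrite !mxE /=; ring. Qed.

Lemma eigR_uneig q : eigR (uneig q) = q.2.
Proof. by apply/rowP => j; rewrite !mxE /=; ring. Qed.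

Lemma eigK p : uneig (eigL p, eigR p) = p.
Proof.
by case: p => x y; congr pair; apply/rowP => j; rewrite !mxE /=; ring.
Qed.

Lemma eigL_corner d p i : eigL (corner d p i) = eigL p + (i : nat)%:R *: eigL d.
Proof.
have F5 : 5%:R = 0 :> 'F_5 by apply: val_inj.
(* The eigenvalue relations hold only modulo 5, while [ring] argues over the integers; the multiple
   of 5 is supplied by hand. *)
have modF (x y z : 'F_5) : x = y + 5%:R * z -> x = y by rewrite F5 mul0r addr0.
apply/rowP => j; case: i => -[|[|[|[|//]]]] lt_i; rewrite !mxE /=.
- by ring.
- by ring.
- by apply: (modF _ _ (- d.1 0 j - d.2 0 j)); ring.
- by apply: (modF _ _ (- d.1 0 j - d.2 0 j)); ring.
Qed.

Lemma eigR_corner d p i : eigR (corner d p i) = eigR p + (slope i)%:R *: eigR d.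
Proof.
have F5 : 5%:R = 0 :> 'F_5 by apply: val_inj.
have modF (x y z : 'F_5) : x = y + 5%:R * z -> x = y by rewrite F5 mul0r addr0.
apply/rowP => j; case: i => -[|[|[|[|//]]]] lt_i; rewrite !mxE /slope /=.
- by ring.
- by ring.
- by apply: (modF _ _ (- d.1 0 j - d.2 0 j)); ring.
- by apply: (modF _ _ (- d.1 0 j - d.2 0 j)); ring.
Qed.

Lemma eig_neq0 d : d != (0, 0) -> (eigL d, eigR d) != 0.
Proof.
apply: contraNneq => eig0; rewrite -(eigK d) eig0 /uneig /=.
by rewrite !scaler0 !subr0.
Qed.

(** One eigencoordinate of [d] is nonzero, and both 0, 1, 2, 3 and the slopes 0, 1, 3, 4 are
    distinct modulo 5. *)
Lemma corner_inj d p : d != (0, 0) -> injective (corner d p).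
Proof.
move=> /eig_neq0 d0 i j eq_ij.
have natF5_inj (a b : nat) (w : 'rV['F_5]_n) : w != 0 -> (a < 5)%N -> (b < 5)%N ->
    a%:R *: w = b%:R *: w -> a = b.
  move=> w0 a5 b5 /eqP; rewrite -subr_eq0 -scalerBl scaler_eq0 (negPf w0) orbF.
  rewrite subr_eq0 => /eqP /(congr1 val).
  by rewrite /= !val_Fp_nat // !modn_small.
have [eL0|eL0] := eqVneq (eigL d) 0; last first.
  apply: val_inj; apply: (natF5_inj _ _ (eigL d)) => //.
  - by apply: leq_trans (ltn_ord i) _.
  - by apply: leq_trans (ltn_ord j) _.
  by apply: (@addrI _ (eigL p)); rewrite -!eigL_corner eq_ij.
have eR0 : eigR d != 0 by apply: contraNneq d0 => eR0; rewrite eL0 eR0.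
have := congr1 eigR eq_ij; rewrite !eigR_corner => /addrI /natF5_inj eq_slope.
apply: val_inj; have := eq_slope eR0.
by case: i {eq_ij eq_slope} => -[|[|[|[|//]]]] ? /=;
  case: j => -[|[|[|[|//]]]] ? //= /(_ isT isT).
Qed.

Lemma corner_injl d i : injective (corner d ^~ i).
Proof.
move=> p p' eq_pp; rewrite -(eigK p) -(eigK p').
have := congr1 eigL eq_pp; rewrite !eigL_corner => /addIr ->.
by have := congr1 eigR eq_pp; rewrite !eigR_corner => /addIr ->.
Qed.

Lemma squares_in_corners (A : {set point}) d :
  squares_in A d.1 d.2 = [set p | [forall i, corner d p i \in A]].
Proof.
apply/setP => p; rewrite !inE; apply/and4P/forallP => [[A0 A1 A2 A3] i|cornerA].
  by case: i => -[|[|[|[|//]]]] lt_i; rewrite /corner //= [p]surjective_pairing.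
split.
- have := cornerA (Ordinal (isT : 0 < 4)%N).
  by rewrite /corner /= -surjective_pairing.
- exact: (cornerA (Ordinal (isT : 1 < 4)%N)).
- exact: (cornerA (Ordinal (isT : 2 < 4)%N)).
- exact: (cornerA (Ordinal (isT : 3 < 4)%N)).
Qed.

Definition point_weight p : nat :=
  weight (dot (eigL p) (eigL p)) (dot (eigL p) (eigR p)).

Lemma sum_eig (h : 'rV['F_5]_n -> 'rV['F_5]_n -> nat) :
  (\sum_p h (eigL p) (eigR p) = \sum_u \sum_v h u v)%N.
Proof.
rewrite pair_bigA (reindex uneig) /=; last first.
  exists (fun p => (eigL p, eigR p)) => [q|p] _; rewrite ?eigK //.
  by rewrite eigL_uneig eigR_uneig -surjective_pairing.
by apply: eq_bigr => q _; rewrite eigL_uneig eigR_uneig.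
Qed.

(** Expanding the two forms at [u + i s] and [v + (slope i) t] gives the arguments of [weight] in
    [square_weight]. *)
Lemma prod_corner_weight d p :
  (\prod_i point_weight (corner d p i) =
   square_weight (dot (eigL d) (eigL d)) (dot (eigL d) (eigR d))
     (dot (eigL p) (eigL p)) (dot (eigL p) (eigL d)) (dot (eigL p) (eigR d))
     (dot (eigL p) (eigR p)) (dot (eigR p) (eigL d)))%N.
Proof.
apply: eq_bigr => i _; rewrite /point_weight eigL_corner eigR_corner.
move: (eigL d) (eigR d) (eigL p) (eigR p) => s t u v.
rewrite !dotDl !dotDr !dotZl !dotZr (dotC s u) (dotC s v).
by congr weight; rewrite natrM; ring.
Qed.

Lemma pattern_count_corner (R : realType) (kappa : R) d :
  pattern_count (corner d) (fun p => kappa * (point_weight p)%:R) =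
  kappa ^+ 4 * (square_sum (eigL d) (eigR d))%:R.
Proof.
rewrite /square_sum -sum_eig natr_sum mulr_sumr; apply: eq_bigr => p _.
by rewrite -prod_corner_weight big_split /= prodr_const card_ord natr_prod.
Qed.

End Corners.

(** * Choice of the constants and conclusion *)

Theorem theorem1p3 (R : realType) :
  exists c : R, 0 < c /\
    forall alpha : R, 0 < alpha -> alpha < c ->
      exists N : nat, forall n : nat, (N <= n)%N ->
        exists A : {set 'rV['F_5]_n * 'rV['F_5]_n},
          alpha * 5%:R ^+ (2 * n) <= #|A|%:R /\
          (\max_(d : 'rV['F_5]_n * 'rV['F_5]_n | d != (0, 0))
             #|squares_in A d.1 d.2|)%:R
            <= (1 - c) * alpha ^+ 4 * 5%:R ^+ (2 * n).
Proof.
exists (1 / 1000%:R); split=> [|alpha alpha0 alpha_lt]; first by rewrite divr_gt0.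
(* The rounding error [rho * #|T|] must be small against [alpha ^ 4 * #|T|], the scale of the square
   counts. *)
pose rho := alpha ^+ 4 / 10000%:R.
pose eta : R := 1 / 10000%:R.
have a4_gt0 : 0 < alpha ^+ 4 by rewrite exprn_gt0.
have a4_le : alpha ^+ 4 <= alpha.
  by rewrite exprS ler_piMr ?(ltW alpha0) // exprn_ile1 ?(ltW alpha0) //; lra.
have rho01 : 0 < rho <= 1 by rewrite /rho; lra.
have eta_gt0 : 0 < eta by rewrite /eta; lra.
have eta_le1 : eta <= 1 by rewrite /eta; lra.
have c_lt1 : 0 < 1 - 1 / 1000%:R :> R by lra.
(* The first term makes the quadratic forms equidistributed up to [eta], the second lets the
   rounding succeed with error [rho]. *)
pose C := (5 ^ 6)%:R / eta ^+ 2 + (16%:R / rho) ^+ 4.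
have C1_ge0 : 0 <= (5 ^ 6)%:R / eta ^+ 2.
  by rewrite divr_ge0 ?exprn_ge0 ?ler0n // ltW.
have C2_ge0 : 0 <= (16%:R / rho) ^+ 4.
  by case/andP: rho01 => /ltW rho_ge0 _; rewrite exprn_ge0 // divr_ge0.
exists (Num.bound C) => n le_n.
have C_lt : C < (5 ^ n)%:R.
  apply: lt_le_trans (archi_boundP (addr_ge0 C1_ge0 C2_ge0)) _.
  by rewrite ler_nat (leq_trans le_n) // ltnW // ltn_expl.
have n_large : (5 ^ 6)%:R <= eta ^+ 2 * (5 ^ n)%:R.
  rewrite mulrC -ler_pdivrMr ?exprn_gt0 // ltW // (le_lt_trans _ C_lt) //.
  by rewrite /C lerDl.
pose T : finType := ('rV['F_5]_n * 'rV['F_5]_n)%type.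
have card_T : #|{: T}| = (5 ^ (2 * n))%N.
  by rewrite card_prod !card_mx !mul1n card_F5 -expnD addnn -mul2n.
pose D : finType := {d : T | d != (0, 0)}.
have card_D : (#|D| <= #|T|)%N by rewrite card_sig max_card.
(* As the mean weight is 4, this gives density about [1.001 * alpha]; the surplus absorbs the losses
   from [eta] and [rho]. *)
pose kappa := 1001%:R / 4000%:R * alpha.
have k_ge0 : 0 <= kappa by rewrite mulr_ge0 ?ltW // divr_gt0.
pose x (p : T) := kappa * (point_weight p)%:R.
have x01 : frac x.
  move=> p; rewrite /x mulr_ge0 ?ler0n //= /kappa.
  have : (point_weight p)%:R <= 7%:R :> R by rewrite ler_nat weight_le7.
  have : 0 <= (point_weight p)%:R :> R by rewrite ler0n.
  by nra.
have T_large : (16%:R / rho) ^+ 4 <= #|T|%:R.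
  rewrite card_T; apply: (@le_trans _ _ C); first by rewrite /C lerDr.
  apply: le_trans (ltW C_lt) _; by rewrite ler_nat leq_pexp2l // leq_pmull.
have [A [A_ge A_le]] := @random_set R T D (fun d => corner (val d)) x rho
  (fun d p => @corner_inj n (val d) p (valP d)) (fun d => @corner_injl n (val d))
  x01 rho01 card_D T_large.
exists A; move: A_ge A_le; rewrite card_T -natrX => A_ge A_le.
have M_gt0 : 0 < (5 ^ (2 * n))%:R :> R by rewrite ltr0n expn_gt0.
split.
  apply: ltW; apply: le_lt_trans A_ge.
  have -> : \sum_p x p = kappa *
      (\sum_(u : 'rV['F_5]_n) \sum_(v : 'rV['F_5]_n)
         weight (dot u u) (dot u v))%N%:R.
    by rewrite -mulr_sumr -natr_sum -sum_eig.
  have := ler_wpM2l k_ge0 (total_weight_ge (ltW eta_gt0) eta_le1 n_large).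
  move: (\sum_u _)%N%:R => W; move: (5 ^ (2 * n))%:R M_gt0 => M M_gt0.
  have : 0 <= (alpha - alpha ^+ 4) * M by apply: mulr_ge0; lra.
  have : 0 < alpha * M by rewrite mulr_gt0.
  rewrite /kappa /rho /eta; lra.
elim/big_ind: _ => [|a b a_le b_le|d d0].
- by rewrite !mulr_ge0 // ?(ltW M_gt0) ?(ltW a4_gt0) // ltW.
- by rewrite /maxn; case: ifP.
rewrite squares_in_corners.
apply: (le_trans (ltW (A_le (exist _ d d0)))).
rewrite pattern_count_corner /=.
have := ler_wpM2l (exprn_ge0 4 k_ge0)
  (square_sum_le (ltW eta_gt0) eta_le1 n_large (eig_neq0 d0)).
move: (square_sum _ _)%:R => S; move: (5 ^ (2 * n))%:R M_gt0 => M M_gt0.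
have : 0 < alpha ^+ 4 * M by rewrite mulr_gt0.
(* Numerically, [1.001 ^ 4 * 1.0002 * 253 / 256 + 0.0001] is below [0.993], hence below
   [1 - c = 0.999]. *)
rewrite /kappa exprMn /rho /eta; lra.
Qed.
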